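(* Let $T=(n_1,\dots,n_r)$ be a 2-type vector, $n_1<\cdots<n_r$, and let $T'=(m_1,\dots,m_{2r})$ be its associated pseudo type vector. Let $\mathbb X$ be the spread out linear configuration of type $T$ and let $\mathbb Z$ be its first infinitesimal neighborhood. Then: (i) $\mathbb Z$ can be obtained from the empty scheme by a finite sequence of basic double links; (ii) the first difference of the Hilbert function of $\mathbb Z$ is the standard O-sequence associated to $T'$; (iii) the regularity of $\mathbb Z$ is $m_{2r}=2n_r$.
   Context: Work over an infinite field $k$ of characteristic zero, $R=k[x_0,x_1,x_2]$. A 2-type vector is $(n_1,\dots,n_r)$ with integers $0<n_1<\cdots<n_r$. The spread out linear configuration of type $T$ consists, for each $i=1,\dots,r$, of the $n_i$ points $[j:n_r-n_i:1]$, $0\le j\le n_i-1$. The associated pseudo type vector is $T'=(n_1,2n_1,n_2,2n_2,\dots,n_r,2n_r)$ reordered in non-decreasing order, written $(m_1,\dots,m_{2r})$. The first infinitesimal neighborhood of a reduced point set $\{P_1,\dots,P_s\}$ with prime ideals $\wp_i$ is the scheme defined by $\wp_1^2\cap\cdots\cap\wp_s^2$. Hilbert function $h(t)=\dim_k(R/I)_t$, first difference $\Delta h(t)=h(t)-h(t-1)$, regularity = least $t$ with $\Delta h(t)=0$. Standard O-sequence of a sequence $(m_1,\dots,m_p)$ with $m_1\le\cdots\le m_p$: set $m_0=0,m_{p+1}=\infty$. If $m_{i-1}<m_i<m_{i+1}$, $(s_i)_t=1$ for $0\le t\le m_i-1$, $0$ otherwise; if $m_{i-1}=m_i<m_{i+1}$,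 $(s_i)_0=1$, $(s_i)_t=2$ for $1\le t\le m_i-1$, $(s_i)_{m_i}=1$, $0$ otherwise; if $m_{i-1}<m_i=m_{i+1}$, $s_i$ is undefined. The standard O-sequence is $\sum_i s_i(i-p)$ over defined $s_i$, where $s(-k)_t=s_{t-k}$. Basic double link: for a zero-dimensional scheme $\mathbb Y$ (or empty, ideal $R$), forms $F\in I_{\mathbb Y}$ and $G$ forming a regular sequence, the saturated ideal $G\cdot I_{\mathbb Y}+(F)$ defines a basic double link of $\mathbb Y$. *)

(* Defs.v *)
From HB Require Import structures.
From mathcomp Require Import all_boot all_order all_algebra.
From mathcomp Require Import mpoly.
Set Implicit Arguments. Unset Strict Implicit. Unset Printing Implicit Defensive.
Import Order.TTheory GRing.Theory.
Local Open Scope ring_scope.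

Section Defs.
Variable k : fieldType.

Notation R := {mpoly k[3]}.

Definition ideal_of := R -> Prop.

(* f is a form (homogeneous polynomial) of degree d; 0 is a form of every degree *)
Definition is_form (d : nat) (f : R) : bool := f \is @ishomog1 3 k d mdeg.
Definition form (f : R) : Prop := exists d, is_form d f.

(* a point of P^2, given by homogeneous coordinates *)
Definition point := 'I_3 -> k.

Definition pt (a b c : k) : point :=
  fun i => match val i with 0%N => a | 1%N => b | _ => c end.

Definition point_ideal (P : point) : ideal_of := fun f =>
  exists s : seq (R * R),
    (forall x, x \in s -> form x.1 /\ x.1.@[P] = 0) /\
    f = \sum_(x <- s) x.1 * x.2.

Definition ideal_sq (I : ideal_of) : ideal_of := fun f =>
  exists s : seq (R * R),
    (forall x, x \in s -> I x.1 /\ I x.2) /\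
    f = \sum_(x <- s) x.1 * x.2.

Definition regular_seq (F G : R) : Prop :=
  F != 0 /\
  (forall h : R, (exists q, G * h = F * q) -> exists q, h = F * q) /\
  ~ (exists a b : R, F * a + G * b = 1).

Definition bdl_ideal (I : ideal_of) (F G : R) : ideal_of := fun f =>
  exists a b : R, I a /\ f = G * a + F * b.

Definition bdl_step_ok (I : ideal_of) (F G : R) : Prop :=
  form F /\ form G /\ I F /\ regular_seq F G.

(* the unit ideal R (ideal of the empty scheme) *)
Definition unit_ideal : ideal_of := fun _ => True.

Fixpoint bdl_chain (I : ideal_of) (s : seq (R * R)) (J : ideal_of) : Prop :=
  match s with
  | [::] => forall f, J f <-> I f
  | x :: s' => bdl_step_ok I x.1 x.2 /\ bdl_chain (bdl_ideal I x.1 x.2) s' J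
  end.

(* dimension of (R/I)_t: hdim I t n iff n is the maximal number of degree t
   forms which are linearly independent modulo I *)
Definition indep_mod (I : ideal_of) (t : nat) (s : seq R) : Prop :=
  (forall p, p \in s -> is_form t p) /\ uniq s /\
  forall c : R -> k, I (\sum_(p <- s) c p *: p) -> forall p, p \in s -> c p = 0.

Definition hdim (I : ideal_of) (t n : nat) : Prop :=
  (exists s, indep_mod I t s /\ size s = n) /\
  (forall s, indep_mod I t s -> (size s <= n)%N).

End Defs.

Definition diff1 (h : nat -> nat) (t : nat) : int :=
  (h t)%:Z - (if t is t'.+1 then h t' else 0%N)%:Z.

Definition two_type (T : seq nat) : Prop :=
  T != [::] /\ (forall n, n \in T -> (0 < n)%N) /\ sorted ltn T.

Definition pseudo_type (T : seq nat) : seq nat :=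
  sort leq (flatten [seq [:: n; n.*2] | n <- T]).

(* standard O-sequence of m = (m_1,...,m_p) (1-indexed; m_0 = 0, m_{p+1} = oo) *)
Definition mth (m : seq nat) (i : nat) : nat :=
  if i is i.+1 then nth 0%N m i else 0%N.

(* value at t of s_i, or 0 if s_i is undefined *)
Definition s_comp (m : seq nat) (i t : nat) : nat :=
  let p := size m in
  if (i < p)%N && (mth m i == mth m i.+1) then 0%N            (* undefined *)
  else if mth m i.-1 == mth m i then
    (if t == 0%N then 1%N
     else if (t < mth m i)%N then 2%N
     else if t == mth m i then 1%N else 0%N)
  else (if (t < mth m i)%N then 1%N else 0%N).

(* sum over i=1..p of s_i(i-p) at t, i.e. (s_i)_{t-(p-i)} *)
Definition std_Oseq (m : seq nat) (t : nat) : nat :=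
  let p := size m in
  \sum_(1 <= i < p.+1 | (p - i <= t)%N) s_comp m i (t - (p - i)).

Section Config.
Variable k : fieldType.

(* the spread out linear configuration of type T = (n_1,...,n_r):
   for each i, the n_i points [j : n_r - n_i : 1], 0 <= j <= n_i - 1
   (0-indexed here: i < size T, n_i = nth 0 T i, n_r = last 0 T) *)
Definition spread_out_point (T : seq nat) (i j : nat) : point k :=
  pt (j%:R) ((last 0%N T - nth 0%N T i)%:R) 1.

Definition first_inf_nbhd_ideal (T : seq nat) : ideal_of k := fun f =>
  forall i j, (i < size T)%N -> (j < nth 0%N T i)%N ->
    ideal_sq (@point_ideal k (spread_out_point T i j)) f.

End Config.

(* Main.v *)
Require Import Defs.
From HB Require Import structures.
From mathcomp Require Import all_boot all_order all_algebra.
From mathcomp Require Import ring zify.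
From mathcomp Require Import mpoly.
Import Order.TTheory GRing.Theory.

Set Implicit Arguments. Unset Strict Implicit. Unset Printing Implicit Defensive.

(* Each row of the configuration lies on a horizontal line L, and L is used twice
   as the form G, with F of degree n and then of degree 2n, in the order
   prescribed by T'; after e uses the points of the row carry multiplicity e.  The
   form F of degree m is a product of ceil(m/2) vertical lines through the first
   points of the rows and floor(m/2) diagonals through their last points: it
   passes through the rows already treated with their current multiplicities, and
   cuts the row of degree m = e n in exactly e times each of its points.  So
   modulo L a form vanishing on the new scheme is divisible by F, which identifies
   the basic double link.  Each step gives
   h_new(t) = h_old(t - 1) + min(t + 1, m), and summing the differences gives the
   standard O-sequence. *)

(** * Triples and the three indices *)

Section Triples.
Local Open Scope ring_scope.

Definition o0 : 'I_3 := @Ordinal 3 0 isT.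
Definition o1 : 'I_3 := @Ordinal 3 1 isT.
Definition o2 : 'I_3 := @Ordinal 3 2 isT.

Definition tri (A : Type) (a b c : A) : 'I_3 -> A :=
  fun i => match val i with 0%N => a | 1%N => b | _ => c end.

Lemma ord3P (P : 'I_3 -> Prop) : P o0 -> P o1 -> P o2 -> forall i, P i.
Proof.
move=> P0 P1 P2 [[|[|[|//]]] lti].
- by rewrite (_ : Ordinal lti = o0) //; apply: val_inj.
- by rewrite (_ : Ordinal lti = o1) //; apply: val_inj.
- by rewrite (_ : Ordinal lti = o2) //; apply: val_inj.
Qed.

Lemma big_ord3 (A : Type) (idx : A) (op : Monoid.law idx) (F : 'I_3 -> A) :
  \big[op/idx]_i F i = op (F o0) (op (F o1) (F o2)).
Proof.
rewrite !big_ord_recl big_ord0 Monoid.mulm1.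
have e0 : ord0 = o0 :> 'I_3 by apply: val_inj.
have e1 : lift ord0 ord0 = o1 :> 'I_3 by apply: val_inj.
have e2 : lift ord0 (lift ord0 ord0) = o2 :> 'I_3 by apply: val_inj.
by rewrite e1 e2 e0.
Qed.

End Triples.

(** * Ideals and substitutions in [k[x0,x1,x2]] *)

Section Algebra.
Local Open Scope ring_scope.
Variable k : fieldType.
Notation R := {mpoly k[3]}.
Notation X0 := ('X_o0 : R).
Notation X1 := ('X_o1 : R).
Notation X2 := ('X_o2 : R).

Definition is_ideal (I : R -> Prop) : Prop :=
  [/\ I 0, forall f g, I f -> I g -> I (f + g) & forall f g, I f -> I (g * f)].

Lemma is_idealN (I : R -> Prop) f : is_ideal I -> I f -> I (- f).
Proof. by case=> _ _ mulI If; rewrite -mulN1r; apply: mulI. Qed.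

Lemma is_idealB (I : R -> Prop) f g : is_ideal I -> I f -> I g -> I (f - g).
Proof. by move=> idI If Ig; have [_ addI _] := idI; apply: addI => //; apply: is_idealN. Qed.

Lemma is_ideal_sum (I : R -> Prop) (J : Type) (r : seq J) (P : pred J)
    (F : J -> R) : is_ideal I -> (forall i, P i -> I (F i)) ->
  I (\sum_(i <- r | P i) F i).
Proof. by case=> I0 addI _; apply: big_ind. Qed.

Lemma is_idealZ (I : R -> Prop) c f : is_ideal I -> I f -> I (c *: f).
Proof. by case=> _ _ mulI If; rewrite -mul_mpolyC; apply: mulI. Qed.

Lemma mpolyX3 (m : 'X_{1..3}) :
  'X_[m] = X0 ^+ m o0 * (X1 ^+ m o1 * X2 ^+ m o2).
Proof. by rewrite mpolyXE_id big_ord3. Qed.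

Lemma mmap1_3 (S : comNzRingType) (h : 'I_3 -> S) (m : 'X_{1..3}) :
  mmap1 h m = h o0 ^+ m o0 * (h o1 ^+ m o1 * h o2 ^+ m o2).
Proof. by rewrite /mmap1 big_ord3. Qed.

Lemma mdeg3 (m : 'X_{1..3}) : mdeg m = (m o0 + (m o1 + m o2))%N.
Proof. by rewrite mdegE big_ord3. Qed.

Notation subst s := (mmap (@mpolyC 3 k) s).

Lemma substZ (s : 'I_3 -> R) c f : subst s (c *: f) = c *: subst s f.
Proof. by rewrite mmapZ mul_mpolyC. Qed.

Lemma substX (s : 'I_3 -> R) i : subst s 'X_i = s i.
Proof. by rewrite mmapX mmap1U. Qed.

(** Congruence modulo an ideal is compatible with sums and products, so agreement on the variables
    propagates to all monomials and then to all polynomials. *)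
Lemma subst_mod (I : R -> Prop) (s : 'I_3 -> R) :
  is_ideal I -> (forall i, I ('X_i - s i)) -> forall f, I (f - subst s f).
Proof.
move=> idI Is; have [I0 addI mulI] := idI; elim/mpolyind => [|c m p _ _ IHp].
  by rewrite raddf0 subrr.
have congM x x' y y' : I (x - x') -> I (y - y') -> I (x * y - x' * y').
  move=> Ix Iy; rewrite (_ : _ - _ = y * (x - x') + x' * (y - y')); last by ring.
  by apply: addI; apply: mulI.
have congX x x' n : I (x - x') -> I (x ^+ n - x' ^+ n).
  by move=> Ix; elim: n => [|n IHn]; [rewrite !expr0 subrr|rewrite !exprS; apply: congM].
rewrite raddfD /= substZ mmapX mpolyX3 mmap1_3 opprD addrACA; apply: addI => //.
rewrite -scalerBr; apply: is_idealZ => //.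
by apply: (congM); [|apply: (congM)]; apply: congX.
Qed.

End Algebra.

(** * Lines, points and multiplicity at a point *)

Section Points.
Local Open Scope ring_scope.
Variable k : fieldType.
Notation R := {mpoly k[3]}.
Notation X0 := ('X_o0 : R).
Notation X1 := ('X_o1 : R).
Notation X2 := ('X_o2 : R).
Notation subst s := (mmap (@mpolyC 3 k) s).

Definition xline (a : k) : R := X0 - a *: X2.
Definition yline (b : k) : R := X1 - b *: X2.

(** Graded restriction to the point [[a:b:1]]: substituting multiples of [X2] instead of scalars
    keeps the degree visible, so the kernel is the homogeneous ideal of the point even on
    polynomials that are not forms. [xres] and [yres] restrict to a vertical and a horizontal line
    in the same way. *)
Definition proj (a b : k) : R -> R := subst (tri (a *: X2) (b *: X2) X2).
Definition xres (a : k) : R -> R := subst (tri (a *: X2) X1 X2).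
Definition yres (b : k) : R -> R := subst (tri X0 (b *: X2) X2).

HB.instance Definition _ a b := GRing.RMorphism.on (proj a b).
HB.instance Definition _ a := GRing.RMorphism.on (xres a).
HB.instance Definition _ b := GRing.RMorphism.on (yres b).

Lemma projD a b : {morph proj a b : f g / f + g}.
Proof. exact: raddfD. Qed.

Lemma projM a b : {morph proj a b : f g / f * g}.
Proof. exact: rmorphM. Qed.

Lemma X2_neq0 : X2 != 0.
Proof.
apply/eqP => /(congr1 (mcoeff U_(o2))); rewrite mcoeffX mcoeff0 eqxx.
by apply/eqP; rewrite oner_eq0.
Qed.

Lemma proj_xline a b : proj a b (xline a) = 0.
Proof. by rewrite /proj raddfB /= substZ !substX subrr. Qed.

Lemma proj_yline a b c : proj a b (yline c) = (b - c) *: X2.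
Proof. by rewrite /proj raddfB /= substZ !substX /= scalerBl. Qed.

Lemma xres_xline a b : xres a (xline b) = (a - b) *: X2.
Proof. by rewrite /xres raddfB /= substZ !substX /= scalerBl. Qed.

Lemma yres_xline a b : yres b (xline a) = xline a.
Proof. by rewrite /yres raddfB /= substZ !substX. Qed.

Lemma yres_yline b c : yres b (yline c) = (b - c) *: X2.
Proof. by rewrite /yres raddfB /= substZ !substX /= scalerBl. Qed.

Lemma principal_ideal (l : R) : is_ideal (fun f => exists q, f = l * q).
Proof.
split=> [|f g [q ->] [q' ->]|f g [q ->]]; first by exists 0; rewrite mulr0.
  by exists (q + q'); rewrite mulrDr.
by exists (g * q); rewrite mulrCA.
Qed.

Lemma xres_mod a f : exists q, f - xres a f = xline a * q.
Proof.
apply: (@subst_mod k (fun f => exists q, f = xline a * q));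
  first exact: principal_ideal.
by elim/ord3P; [exists 1; rewrite mulr1|exists 0|exists 0];
  rewrite ?mulr0 ?subrr.
Qed.

Lemma yres_mod b f : exists q, f - yres b f = yline b * q.
Proof.
apply: (@subst_mod k (fun f => exists q, f = yline b * q));
  first exact: principal_ideal.
by elim/ord3P; [exists 0|exists 1; rewrite mulr1|exists 0];
  rewrite ?mulr0 ?subrr.
Qed.

Lemma proj_mod a b f : exists g h, f - proj a b f = xline a * g + yline b * h.
Proof.
apply: (@subst_mod k (fun f => exists g h, f = xline a * g + yline b * h)).
  split=> [|f1 f2 [g1 [h1 ->]] [g2 [h2 ->]]|f1 f2 [g1 [h1 ->]]].
  - by exists 0, 0; rewrite !mulr0 addr0.
  - by exists (g1 + g2), (h1 + h2); rewrite !mulrDr addrACA.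
  - by exists (f2 * g1), (f2 * h1); rewrite mulrDr !(mulrCA f2).
by elim/ord3P; [exists 1, 0|exists 0, 1|exists 0, 0];
  rewrite ?mulr1 ?mulr0 ?add0r ?addr0 ?subrr.
Qed.

Lemma proj_ker a b f : proj a b f = 0 ->
  exists g h, f = xline a * g + yline b * h.
Proof. by move=> f0; have [g [h]] := proj_mod a b f; rewrite f0 subr0; exists g, h. Qed.

Lemma xres_ker a f : xres a f = 0 -> exists q, f = xline a * q.
Proof. by move=> f0; have [q] := xres_mod a f; rewrite f0 subr0; exists q. Qed.

Lemma yres_ker b f : yres b f = 0 -> exists q, f = yline b * q.
Proof. by move=> f0; have [q] := yres_mod b f; rewrite f0 subr0; exists q. Qed.

Lemma yres_id b (f : R) : yres b (yres b f) = yres b f.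
Proof.
have [h eqh] := yres_mod b f; apply/eqP; rewrite eq_sym -subr_eq0 -[_ - _]raddfB /=.
by rewrite eqh rmorphM /= yres_yline subrr scale0r mul0r.
Qed.

Lemma xline_form a : xline a \is 1.-homog.
Proof. by rewrite rpredB ?rpredZ // dhomogX; apply/eqP/mdeg1. Qed.

Lemma yline_form a : yline a \is 1.-homog.
Proof. by rewrite rpredB ?rpredZ // dhomogX; apply/eqP/mdeg1. Qed.

Lemma xline_neq0 a : xline a != 0.
Proof.
apply/eqP => /(congr1 (fun f => f.@[tri (a + 1) 0 1])).
rewrite meval0 mevalB mevalZ !mevalXU /= mulr1 addrAC subrr add0r.
by apply/eqP; rewrite oner_eq0.
Qed.

Lemma yline_neq0 b : yline b != 0.
Proof.
apply/eqP => /(congr1 (fun f => f.@[tri 0 (b + 1) 1])).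
rewrite meval0 mevalB mevalZ !mevalXU /= mulr1 addrAC subrr add0r.
by apply/eqP; rewrite oner_eq0.
Qed.

Lemma proj_form a b d f : f \is d.-homog ->
  proj a b f = f.@[pt a b 1] *: X2 ^+ d.
Proof.
move=> /dhomogP homf; rewrite /proj /mmap /meval /mmap scaler_suml.
rewrite big_seq [in RHS]big_seq; apply: eq_bigr => m /homf <-.
rewrite !mmap1_3 /= mul_mpolyC mdeg3 expr1n mulr1 /pt /= -scalerA; congr (_ *: _).
by rewrite !exprZn !exprD -!mul_mpolyC mpolyCM; ring.
Qed.

(** A form of degree [d] restricts to its value times [X2 ^+ d], so the generators die under [proj];
    conversely the kernel is generated by the two lines through the point. *)
Lemma point_idealE a b f : point_ideal (pt a b 1) f <-> proj a b f = 0.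
Proof.
split=> [[s [s0 ->]]|/proj_ker [g [h ->]]].
  rewrite raddf_sum /= big_seq big1 // => x /s0 [[d xd] x0].
  by rewrite rmorphM /= (proj_form a b xd) x0 scale0r mul0r.
exists [:: (xline a, g); (yline b, h)].
rewrite !big_cons big_nil addr0; split=> // x; rewrite !inE => /orP[]/eqP->;
  (split; [exists 1%N|]).
- exact: xline_form.
- by rewrite mevalB mevalZ !mevalXU mulr1 subrr.
- exact: yline_form.
- by rewrite mevalB mevalZ !mevalXU mulr1 subrr.
Qed.

(** Multiplicity at least [e] at [[a:b:1]], for [e <= 2]; the two derivatives are those of the
    affine chart [X2 = 1], and [e = 0] imposes nothing. *)
Definition van (e : nat) (a b : k) (f : R) : Prop :=
  ((0 < e)%N -> proj a b f = 0) /\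
  ((1 < e)%N -> proj a b f^`M(o0) = 0 /\ proj a b f^`M(o1) = 0).

Lemma van_ideal e a b : is_ideal (van e a b).
Proof.
split=> [|f g [f0 f1] [g0 g1]|f g [f0 f1]]; split=> e0.
- exact: raddf0.
- by rewrite !mderiv0 raddf0.
- by rewrite projD f0 // g0 // addr0.
- have [f10 f11] := f1 e0; have [g10 g11] := g1 e0.
  by rewrite !mderivD !projD f10 f11 g10 g11 addr0.
- by rewrite projM f0 ?mulr0.
- have [f10 f11] := f1 e0; have f00 := f0 (ltnW e0).
  by rewrite !mderivM !projD !projM f10 f11 f00 !mulr0 addr0.
Qed.

(** Multiplicities add, by the Leibniz rule. *)
Lemma vanM e e' a b f g : (e + e' <= 2)%N ->
  van e a b f -> van e' a b g -> van (e + e') a b (f * g).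
Proof.
move=> le2 [f0 f1] [g0 g1]; split=> ee; rewrite ?mderivM ?projD ?projM.
  by case: e f0 {f1} le2 ee => [|e] f0 le2 ee; [rewrite g0 ?mulr0|rewrite f0 ?mul0r].
case: e f0 f1 le2 ee => [|[|[|//]]] f0 f1 le2 ee.
- have [-> ->] := g1 ee; rewrite (g0 (ltnW ee)) ?mulr0 ?addr0 //.
- by rewrite f0 // g0 // !mulr0 !mul0r addr0.
- by have [-> ->] := f1 isT; rewrite f0 // !mul0r addr0.
Qed.

Lemma van1 a b f : proj a b f = 0 -> van 1 a b f.
Proof. by []. Qed.

Lemma van_leq e e' a b f : (e <= e')%N -> van e' a b f -> van e a b f.
Proof.
by move=> lee [f0 f1]; split=> e0; [apply: f0|apply: f1]; apply: leq_trans lee.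
Qed.

Lemma deriv_yline b : ((yline b)^`M(o0) = 0) * ((yline b)^`M(o1) = 1).
Proof.
rewrite !mderivB !mderivZ !mderivX !mnm1E !eqE /= !scale0r !scaler0 !subr0.
by split=> //; rewrite scale1r -mpolyX0; congr 'X_[_]; apply/mnmP => i;
  rewrite mnmBE subnn mnm0E.
Qed.

(** At a point of the line, the [X1]-derivative of [yline b * g] restricts to [g] itself. *)
Lemma van_colon_on e a b g : (e <= 1)%N ->
  van e.+1 a b (yline b * g) -> van e a b g.
Proof.
move=> le1 [_ h1]; split; last by rewrite ltnNge le1.
move=> e0; have [_] := h1 e0; rewrite mderivM !deriv_yline.
by rewrite mul1r projD projM proj_yline subrr scale0r mul0r addr0.
Qed.

(** Away from the line, the restriction of [yline c] is a nonzero multiple of [X2] and cancels in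
    the domain [R], first from the value and then from the derivatives. *)
Lemma van_colon_off e a b c g : b != c ->
  van e a b (yline c * g) -> van e a b g.
Proof.
move=> neq [h0 h1].
have L0 : proj a b (yline c) != 0 by rewrite proj_yline scaler_eq0 subr_eq0 negb_or neq X2_neq0.
have g0 : (0 < e)%N -> proj a b g = 0.
  by move/h0/eqP; rewrite projM mulf_eq0 (negPf L0) => /eqP.
split=> // e1; have [] := h1 e1; rewrite !mderivM !projD !projM.
rewrite g0 ?mulr0 ?add0r ?(ltnW e1) // => /eqP+ /eqP.
by rewrite !mulf_eq0 (negPf L0) => /eqP-> /eqP->.
Qed.

Lemma deriv_xline b : ((xline b)^`M(o0) = 1) * ((xline b)^`M(o1) = 0).
Proof.
rewrite !mderivB !mderivZ !mderivX !mnm1E !eqE /= !scale0r !scaler0 !subr0.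
by split=> //; rewrite scale1r -mpolyX0; congr 'X_[_]; apply/mnmP => i;
  rewrite mnmBE subnn mnm0E.
Qed.

(** Once [f] is written in terms of the two lines, its derivatives at the point are the values of
    the two cofactors. *)
Lemma van2_decomp a b f : van 2 a b f -> exists g h,
  [/\ f = xline a * g + yline b * h, proj a b g = 0 & proj a b h = 0].
Proof.
case=> /(_ isT)/proj_ker [g [h ->]] /(_ isT) [].
rewrite !mderivD !mderivM !deriv_xline !deriv_yline !mul1r !mul0r !projD !projM proj_xline proj_yline.
rewrite subrr scale0r !mul0r !raddf0 !addr0 !add0r => g0 h0.
by exists g, h.
Qed.

Lemma van2_square a b f : ideal_sq (point_ideal (pt a b 1)) f <-> van 2 a b f.
Proof.
split=> [[s [sI ->]]|/van2_decomp [g [h [-> g0 h0]]]].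
  rewrite big_seq; apply: is_ideal_sum => [|x /sI []]; first exact: van_ideal.
  by move=> /point_idealE/van1 x1 /point_idealE/van1; apply: (@vanM 1 1).
exists [:: (xline a, g); (yline b, h)]; rewrite !big_cons big_nil addr0.
split=> // x; rewrite !inE => /orP[]/eqP-> /=; split; apply/point_idealE => //.
  exact: proj_xline.
by rewrite proj_yline subrr scale0r.
Qed.

(** Multiplicity [e] at a point becomes an [e]-fold zero after restriction to the horizontal line
    through it. *)
Lemma van_yres e a b f : (e <= 2)%N -> van e a b f ->
  exists q, yres b f = xline a ^+ e * q.
Proof.
have aux g : proj a b g = 0 -> exists q, yres b g = xline a * q.
  move=> /proj_ker [q [h ->]]; exists (yres b q).
  by rewrite rmorphD !rmorphM /= yres_xline yres_yline subrr scale0r mul0r addr0.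
case: e => [|[|[|//]]] _ vanf.
- by exists (yres b f); rewrite expr0 mul1r.
- by rewrite expr1; apply: aux; case: vanf => /(_ isT).
have [g [h [-> /aux [q gq] _]]] := van2_decomp vanf; exists q.
by rewrite rmorphD !rmorphM /= yres_xline gq yres_yline subrr scale0r mul0r addr0 mulrA.
Qed.

(** The kernel of [xres a] is the prime ideal of [xline a]; as [w] lies outside it, the factors of
    the power pass to [q] one at a time. *)
Lemma xline_pow_cancel a e w q h : xres a w != 0 ->
  w * q = xline a ^+ e * h -> exists h', q = xline a ^+ e * h'.
Proof.
move=> w0; elim: e h => [|e IHe] h; first by exists q; rewrite expr0 mul1r.
rewrite exprSr -mulrA => eqw; have [h' eqq] := IHe _ eqw.
have : w * h' = xline a * h.
  apply: (@mulfI _ (xline a ^+ e)); first by rewrite expf_neq0 ?xline_neq0.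
  by rewrite -eqw eqq mulrCA.
move/(congr1 (xres a))/eqP; rewrite !rmorphM /= xres_xline subrr scale0r mul0r.
rewrite mulf_eq0 (negPf w0) => /eqP/xres_ker [h'' eqh'].
by exists h''; rewrite eqq eqh' mulrA.
Qed.

(** Distinct vertical lines are non-associated primes, so the powers already extracted are nonzero
    on the next line. *)
Lemma xline_prod_dvd (A : seq k) e f : uniq A ->
  (forall a, a \in A -> exists q, f = xline a ^+ e * q) ->
  exists q, f = (\prod_(a <- A) xline a ^+ e) * q.
Proof.
elim: A => [|a A IHA] /=; first by exists f; rewrite big_nil mul1r.
case/andP=> aA uA dvdf; have [b bA|q eqf] := IHA uA.
  by apply: dvdf; rewrite inE bA orbT.
have [h eqf'] := dvdf a (mem_head _ _); rewrite eqf in eqf'.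
have w0 : xres a (\prod_(b <- A) xline b ^+ e) != 0.
  rewrite rmorph_prod prodf_seq_neq0; apply/allP => b bA /=.
  rewrite rmorphXn expf_neq0 //= xres_xline scaler_eq0 subr_eq0 negb_or X2_neq0.
  by rewrite andbT; apply: contraNneq aA => ->.
have [h' eqq] := xline_pow_cancel w0 eqf'.
by exists h'; rewrite eqf eqq big_cons mulrCA mulrA.
Qed.

End Points.

(** * Rows of points and the curves used in the links *)

Section Configuration.
Local Open Scope ring_scope.
Variable k : fieldType.
Hypothesis char0 : [pchar k] =i pred0.
Notation R := {mpoly k[3]}.
Notation X0 := ('X_o0 : R).
Notation X1 := ('X_o1 : R).
Notation X2 := ('X_o2 : R).
Variables (T : seq nat) (N : nat).
Hypothesis leTN : forall n, n \in T -> (n <= N)%N.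
Hypothesis T_gt0 : forall n, n \in T -> (0 < n)%N.

Definition height (n : nat) : k := (N - n)%:R.

(** A row is named by its number of points [n], and [e n] is the multiplicity currently imposed
    along it. *)
Definition conf (e : nat -> nat) (f : R) : Prop :=
  forall n j, n \in T -> (j < n)%N -> van (e n) j%:R (height n) f.

Lemma conf_ideal e : is_ideal (conf e).
Proof.
split=> [|f g If Ig|f g If] n j nT ltj; have [i0 iD iM] := van_ideal (e n) j%:R (height n).
- exact: i0.
- by apply: iD; [apply: If|apply: Ig].
- by apply: iM; apply: If.
Qed.

Lemma natr_inj : injective (fun n : nat => n%:R : k).
Proof.
move=> m n; wlog lemn : m n / (m <= n)%N => [hw|eqmn].
  by have [/hw//|/ltnW/hw eqnm /esym/eqnm] := leqP m n.
apply/eqP; rewrite eqn_leq lemn -subn_eq0 -((pcharf0P _).1 char0).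
by rewrite andTb natrB // eqmn subrr eqxx.
Qed.

Lemma height_inj : {in T &, injective height}.
Proof.
move=> m n /leTN lem /leTN len /natr_inj; lia.
Qed.

(** In a row of [n > b] points this diagonal passes through [j = n - 1 - b], since
    [j + (N - n) = N - 1 - b] does not depend on [n]. *)
Definition dline (b : nat) : R := X0 + X1 - (N%:R - 1 - b%:R) *: X2.

Lemma dline_form b : dline b \is 1.-homog.
Proof.
by rewrite rpredB ?rpredD ?rpredZ // dhomogX; apply/eqP/mdeg1.
Qed.

Lemma yres_dline n b : (b < n <= N)%N ->
  yres (height n) (dline b) = xline ((n.-1 - b)%:R : k).
Proof.
case/andP=> ltb len; rewrite /yres raddfB raddfD /= substZ !substX /= /xline /height.
rewrite -addrA -scalerBl; congr (_ + _); rewrite -scaleNr; congr (_ *: _).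
rewrite natrB // (_ : n.-1 - b = n - b.+1)%N; last by lia.
by rewrite natrB // -[b.+1]addn1 natrD; ring.
Qed.

Definition pts (n : nat) : seq k := [seq j%:R | j <- iota 0 n].

Definition curve (m : nat) : R :=
  (\prod_(0 <= j < uphalf m) xline (j%:R : k)) * \prod_(0 <= b < m./2) dline b.

Lemma curve_form m : curve m \is m.-homog.
Proof.
have lin (l : nat -> R) q : (forall j, l j \is 1.-homog) ->
    \prod_(0 <= j < q) l j \is q.-homog.
  move=> lh; elim: q => [|q IHq]; first by rewrite big_nil dhomog1.
  by rewrite big_nat_recr //= -[q.+1]addn1; apply: dhomogM.
have eqm : (uphalf m + m./2 = m)%N by lia.
rewrite -{2}eqm; apply: dhomogM; apply: lin => j.
  exact: xline_form.
exact: dline_form.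
Qed.

(** For degree [n] the verticals take the left half of the row and the diagonals the right half; for
    degree [2n] each family sweeps the whole row once. *)
Lemma curve_yres n e : (n <= N)%N -> (e <= 1)%N ->
  yres (height n) (curve (e.+1 * n)) = \prod_(a <- pts n) xline a ^+ e.+1.
Proof.
move=> len lee; have -> : \prod_(a <- pts n) xline a ^+ e.+1 =
    \prod_(0 <= j < n) xline (j%:R : k) ^+ e.+1.
  by rewrite big_map /index_iota subn0.
rewrite rmorphM !rmorph_prod /=.
under eq_bigr do rewrite yres_xline.
(* Diagonals count the points from the right, so their product is reversed to match the
   verticals. *)
have rev q : (q <= n)%N -> \prod_(0 <= b < q) yres (height n) (dline b)
    = \prod_(n - q <= j < n) xline (j%:R : k).
  move=> leq; rewrite -{1}[(n - q)%N]add0n big_addn subKn // big_nat_rev /=.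
  rewrite big_nat [RHS]big_nat; apply: eq_bigr => j ltj.
  by rewrite yres_dline; [congr (xline _%:R); lia | lia].
case: e lee => [|[|//]] _.
  rewrite mul1n rev; last by lia.
  rewrite (_ : n - n./2 = uphalf n)%N; last by lia.
  under [RHS]eq_bigr do rewrite expr1.
  by rewrite [RHS](@big_cat_nat _ _ _ (uphalf n)) //=; lia.
under [RHS]eq_bigr do rewrite expr2.
by rewrite mul2n uphalf_double doubleK rev // subnn big_split.
Qed.

Lemma prod_van a b (l : nat -> R) q j : (j < q)%N -> van 1 a b (l j) ->
  van 1 a b (\prod_(0 <= i < q) l i).
Proof.
move=> ltj vl; rewrite big_mkord (bigD1 (Ordinal ltj)) //= mulrC.
by case: (van_ideal 1 a b) => _ _; apply.
Qed.

(* Row [n] carries the points [j = 0, ..., n.-1]; the vertical lines meet it in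
   the points counted from the left, the diagonals in those counted from the
   right. *)
Lemma curve_van e m n j : n \in T -> (j < n)%N -> (e <= 2)%N -> (e * n <= m)%N ->
  van e j%:R (height n) (curve m).
Proof.
move=> nT ltj le2 lem.
pose b1 := (j < uphalf m)%N; pose b2 := (n.-1 - j < m./2)%N.
(* [b1] and [b2] record whether the vertical and the diagonal through the point are factors. If
   neither were, then [m < n]; if only one is, then [m < 2n]. *)
apply: (@van_leq _ _ (b1 + b2)%N).
  by rewrite /b1 /b2; case: e le2 lem => [|[|[|//]]] _ lem //; lia.
apply: vanM; first by case: (b1); case: (b2).
  have [ltm|_] := boolP b1; last by split.
  by apply: (prod_van ltm); apply: van1; apply: proj_xline.
have [ltm|_] := boolP b2; last by split.
apply: (prod_van ltm); apply: van1.
rewrite /proj raddfB raddfD /= substZ !substX /= -scalerDl -scalerBl /height.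
apply/eqP; rewrite scaler_eq0; apply/orP; left; apply/eqP.
have := leTN nT => len.
rewrite natrB // (_ : n.-1 - j = n - j.+1)%N; last by lia.
by rewrite natrB // -[j.+1]addn1 natrD; ring.
Qed.

Definition incr (e : nat -> nat) (n : nat) : nat -> nat :=
  fun i => if i == n then (e i).+1 else e i.

(** Distinct rows have distinct heights, so removing the line costs one multiplicity on row [n] and
    none elsewhere. *)
Lemma conf_colon e n g : n \in T -> (e n <= 1)%N ->
  conf (incr e n) (yline (height n) * g) -> conf e g.
Proof.
move=> nT en1 If i j iT ltj; have := If i j iT ltj; rewrite /incr.
case: eqP => [->|/eqP neq]; first exact: van_colon_on.
by apply: van_colon_off; apply: contraNneq neq => /height_inj ->.
Qed.

(** * One basic double link on a row *)

Section Step.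
Variables (e : nat -> nat) (n : nat).
Hypotheses (nT : n \in T) (en1 : (e n <= 1)%N).
Let m := ((e n).+1 * n)%N.
Hypothesis e_le : forall i, i \in T -> (e i <= 2)%N /\ (e i * i <= m)%N.

Lemma curve_yres_neq0 : yres (height n) (curve m) != 0.
Proof.
rewrite curve_yres ?leTN // prodf_seq_neq0; apply/allP => a _ /=.
by rewrite expf_neq0 ?xline_neq0.
Qed.

Lemma curve_conf : conf (incr e n) (curve m).
Proof.
move=> i j iT ltj; have [le2 lem] := e_le iT; apply: curve_van => //.
  by rewrite /incr; case: eqP => [->|].
by rewrite /incr; case: eqP => [->|].
Qed.

(** The line raises the multiplicity on its own row by one and the curve already vanishes enough.
    Conversely [f] is corrected by a multiple of the curve until it vanishes on the line, and the
    quotient by the line falls in the old ideal by [conf_colon]. *)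
Lemma bdl_conf f :
  bdl_ideal (conf e) (curve m) (yline (height n)) f <-> conf (incr e n) f.
Proof.
have [_ addI mulI] := conf_ideal (incr e n).
split=> [[a [b [Ia ->]]]|If].
  apply: addI; last by rewrite mulrC; apply/mulI/curve_conf.
  move=> i j iT ltj; rewrite /incr; case: eqP => [eqi|_].
    rewrite -[(e i).+1]add1n; apply: vanM; first by rewrite eqi; lia.
      by apply: van1; rewrite eqi proj_yline subrr scale0r.
    exact: Ia.
  by case: (van_ideal (e i) j%:R (height i)) => _ _; apply; apply: Ia.
(* On the line, the restricted curve is exactly the product of the required zeros of [f]. *)
have [q eqf] : exists q, yres (height n) f = yres (height n) (curve m) * q.
  rewrite curve_yres ?leTN //; apply: xline_prod_dvd => [|a].
    by rewrite map_inj_uniq ?iota_uniq //; apply: natr_inj.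
  case/mapP=> j; rewrite mem_iota add0n => /andP[_ ltj] ->.
  have := If n j nT ltj; rewrite /incr eqxx; apply: van_yres; exact: en1.
have [g eqg] : exists g, f - curve m * q = yline (height n) * g.
  apply: yres_ker; rewrite raddfB /= [yres _ (_ * _)]rmorphM /=.
  by rewrite -[yres _ f]yres_id eqf [yres _ (_ * _)]rmorphM /= yres_id subrr.
exists g, q; split; last by rewrite -eqg subrK.
apply: (conf_colon nT en1); rewrite -eqg.
apply: (is_idealB (conf_ideal (incr e n))) => //.
by rewrite mulrC; apply/mulI/curve_conf.
Qed.

Lemma bdl_step_conf : bdl_step_ok (conf e) (curve m) (yline (height n)).
Proof.
split; first by exists m; apply: curve_form.
split; first by exists 1%N; apply: yline_form.
split.
  move=> i j iT ltj; have := curve_conf iT ltj; apply: van_leq.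
  by rewrite /incr; case: eqP.
split.
  by apply: contraNneq curve_yres_neq0 => ->; rewrite raddf0.
split=> [h [q eqq]|[a [b]]].
  (* The line is not a component of the curve, so restricting the relation to the line forces the
     line to divide [q]. *)
  have /yres_ker [q' eqq'] : yres (height n) q = 0.
    apply/eqP; have /(congr1 (yres (height n)))/eqP := eqq.
    rewrite [yres _ (_ * h)]rmorphM [yres _ (_ * q)]rmorphM /= yres_yline subrr.
    rewrite scale0r mul0r eq_sym mulf_eq0.
    by rewrite (negPf curve_yres_neq0).
  exists q'; apply: (@mulfI _ (yline (height n))); first exact: yline_neq0.
  by rewrite eqq eqq' mulrCA.
(* Both forms have positive degree and vanish at the origin, where [1] does not. *)
move/(congr1 (fun f => f.@[fun _ => 0]))/eqP; rewrite mevalD !mevalM meval1.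
rewrite mevalB mevalZ !mevalXU mulr0 subrr mul0r addr0.
have m0 : (0 < uphalf m)%N by have := T_gt0 nT; rewrite /m; nia.
rewrite rmorph_prod big_ltn //= mevalB mevalZ !mevalXU mulr0 subrr !mul0r.
by rewrite eq_sym oner_eq0.
Qed.

End Step.
End Configuration.

(** * Restriction to a horizontal line and homogenization *)

Section Hilbert.
Local Open Scope ring_scope.
Variable k : fieldType.
Notation R := {mpoly k[3]}.
Notation X0 := ('X_o0 : R).
Notation X1 := ('X_o1 : R).
Notation X2 := ('X_o2 : R).

(** Restriction to the line [X1 = c X2] in its affine coordinate; univariate polynomials make
    Euclidean division available. *)
Definition dehom (c : k) : R -> {poly k} := mmap (@polyC k) (tri 'X c%:P 1).

HB.instance Definition _ c := GRing.RMorphism.on (dehom c).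

Lemma dehomZ c a f : dehom c (a *: f) = a *: dehom c f.
Proof. by rewrite /dehom mmapZ mul_polyC. Qed.

Lemma dehomM c : {morph dehom c : f g / f * g}.
Proof. exact: rmorphM. Qed.

Lemma dehomX c i : dehom c 'X_i = tri 'X c%:P 1 i.
Proof. by rewrite /dehom mmapX mmap1U. Qed.

Lemma dehom_yline c : dehom c (yline c) = 0.
Proof. by rewrite raddfB /= dehomZ !dehomX /= -mul_polyC mulr1 subrr. Qed.

Lemma dehom_xline c a : dehom c (xline a) = 'X - a%:P.
Proof. by rewrite raddfB /= dehomZ !dehomX /= -mul_polyC mulr1. Qed.

Lemma dehom_yres c f : dehom c f = dehom c (yres c f).
Proof.
have [g eqg] := yres_mod c f; apply/eqP; rewrite -subr_eq0 -[_ - _]raddfB /=.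
by rewrite eqg dehomM dehom_yline mul0r.
Qed.

Definition homz (t : nat) (p : {poly k}) : R :=
  \sum_(0 <= a < t.+1) p`_a *: (X0 ^+ a * X2 ^+ (t - a)).

Lemma homz0 t : homz t 0 = 0.
Proof. by rewrite /homz big1 // => a _; rewrite coef0 scale0r. Qed.

Lemma homzD t p q : homz t (p + q) = homz t p + homz t q.
Proof. by rewrite -big_split; apply: eq_bigr => a _; rewrite coefD scalerDl. Qed.

Lemma homzZ t a p : homz t (a *: p) = a *: homz t p.
Proof. by rewrite scaler_sumr; apply: eq_bigr => b _; rewrite coefZ scalerA. Qed.

Lemma homz_trunc t q (p : {poly k}) : (size p <= q <= t.+1)%N ->
  homz t p = \sum_(a < q) p`_a *: (X0 ^+ a * X2 ^+ (t - a)).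
Proof.
case/andP=> lep leq; rewrite /homz (@big_cat_nat _ _ _ q) //= big_mkord.
rewrite [X in _ + X]big_nat [X in _ + X]big1 ?addr0 // => a /andP[leqa _].
by rewrite nth_default ?scale0r // (leq_trans lep).
Qed.

Lemma homzXn t a : (a <= t)%N -> homz t 'X^a = X0 ^+ a * X2 ^+ (t - a).
Proof.
move=> leat; rewrite (@homz_trunc _ a.+1) ?size_polyXn ?leqnn //.
rewrite big_ord_recr /= coefXn eqxx scale1r big1 ?add0r // => b _.
by rewrite coefXn (ltn_eqF (ltn_ord b)) scale0r.
Qed.

Lemma powX_form i n : ('X_i ^+ n : R) \is n.-homog.
Proof.
by rewrite -[X in X.-homog]mul1n; apply: dhomogMn; rewrite dhomogX; apply/eqP/mdeg1.
Qed.

Lemma monom_form a t : (a <= t)%N -> X0 ^+ a * X2 ^+ (t - a) \is t.-homog.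
Proof.
by move=> leat; rewrite -[in X in X.-homog](subnKC leat) dhomogM ?powX_form.
Qed.

Lemma homz_form t p : homz t p \is t.-homog.
Proof.
rewrite /homz big_nat; apply: rpred_sum => a /andP[_ lta].
by apply/rpredZ/monom_form.
Qed.

Lemma dehom_monom c a b : dehom c (X0 ^+ a * X2 ^+ b) = 'X^a.
Proof. by rewrite dehomM !rmorphXn /= !dehomX /= expr1n mulr1. Qed.

Lemma dehom_homz c t (p : {poly k}) : (size p <= t.+1)%N -> dehom c (homz t p) = p.
Proof.
move=> lep; rewrite (@homz_trunc _ (size p)) ?leqnn // raddf_sum /=.
under eq_bigr do rewrite dehomZ dehom_monom.
by rewrite -poly_def coefK.
Qed.

(** The statement is linear in [f], so monomials suffice, where [X1] is replaced by [c *: X2]. In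
    degree [0] there is no form of degree [t - 1], and the cofactor is zero. *)
Lemma dehom_form c t f : f \is t.-homog ->
  (size (dehom c f) <= t.+1)%N /\
  exists g, f = homz t (dehom c f) + yline c * g /\
    (if t is t'.+1 then g \is t'.-homog else g == 0 :> R).
Proof.
move=> homf; rewrite {1 2 3}[f]mpolyE big_seq.
pose Q f := (size (dehom c f) <= t.+1)%N /\
  exists g, f = homz t (dehom c f) + yline c * g /\
    (if t is t'.+1 then g \is t'.-homog else g == 0 :> R).
rewrite -/(Q _); apply: (big_ind Q).
- split; rewrite raddf0 ?size_poly0 //; exists 0; rewrite homz0 mulr0 addr0.
  by split=> //; case: (t) => // t'; apply: rpred0.
- move=> f1 f2 [s1 [g1 [e1 h1]]] [s2 [g2 [e2 h2]]]; split.
    by rewrite raddfD (leq_trans (size_polyD _ _)) // geq_max s1.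
  exists (g1 + g2); split.
    by rewrite {1}e1 {1}e2 raddfD homzD mulrDr addrACA.
  case: (t) h1 h2 => [/eqP-> /eqP->|t']; first by rewrite addr0.
  exact: rpredD.
move=> m mf; have := dhomog_mf homf mf; move: (f@_m) => a /= eqt {f homf mf}.
suff [s [g [e h]]] : Q 'X_[m].
  split; first by rewrite dehomZ (leq_trans (size_scale_leq _ _)).
  exists (a *: g); split; first by rewrite {1}e dehomZ homzZ scalerDr scalerAr.
  by case: (t) h => [/eqP->|t']; [rewrite scaler0|apply: rpredZ].
rewrite /Q -eqt mpolyX3 mdeg3; move: (m o0) (m o1) (m o2) => i j l {Q t eqt m a}.
have eqd : dehom c (X0 ^+ i * (X1 ^+ j * X2 ^+ l)) = c ^+ j *: 'X^i.
  rewrite !dehomM !rmorphXn /= !dehomX /= expr1n mulr1 -polyC_exp -mul_polyC.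
  exact: mulrC.
split; rewrite eqd.
  by rewrite (leq_trans (size_scale_leq _ _)) // size_polyXn ltnS leq_addr.
rewrite homzZ homzXn ?leq_addr // addKn.
case: j {eqd} => [|j].
  exists 0; rewrite mulr0 addr0 expr0 scale1r mul1r add0n; split=> //.
  by case: (i + l)%N => [|t']; rewrite ?eqxx ?rpred0.
(* The geometric sum: [X1 ^+ j.+1 - (c *: X2) ^+ j.+1] is [yline c] times [s]. *)
pose s : R := \sum_(b < j.+1) X1 ^+ (j.+1.-1 - b) * (c *: X2) ^+ b.
exists (X0 ^+ i * X2 ^+ l * s); split.
  rewrite -[yline c * _]mulrCA -subrXX exprZn exprD -!mul_mpolyC; ring.
rewrite addSn addnS (_ : i + (j + l) = i + l + j)%N; last by lia.
apply: dhomogM; first by apply: dhomogM; apply: powX_form.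
apply: rpred_sum => b _; rewrite exprZn -scalerAr; apply: rpredZ.
have := dhomogM (powX_form o1 (j - b)) (powX_form o2 b).
by rewrite subnK // -ltnS.
Qed.

Lemma ord_empty n : n = 0%N -> 'I_n -> False.
Proof. by move=> -> []. Qed.

(** * Hilbert function values from bases modulo an ideal *)

Section Basis.
Variables (I : R -> Prop) (t n : nat) (B : 'I_n -> R).

Definition free_mod : Prop :=
  forall c : 'I_n -> k, I (\sum_i c i *: B i) -> forall i, c i = 0.

Definition span_mod : Prop := forall f, f \is t.-homog ->
  exists c : 'I_n -> k, I (f - \sum_i c i *: B i).

Definition basis_mod : Prop :=
  [/\ forall i, B i \is t.-homog, free_mod & span_mod].

Lemma basis_hdim : is_ideal I -> basis_mod -> hdim I t n.
Proof.
move=> idI [homB freeB spanB]; have [I0 addI mulI] := idI; split.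
  have injB : injective B.
    move=> i j eqB; apply/eqP/negPn/negP => neq.
    have /freeB/(_ i)/eqP : I (\sum_l ((l == i)%:R - (l == j)%:R) *: B l).
      have del h : \sum_l (l == h)%:R *: B l = B h.
        rewrite (bigD1 h) //= eqxx scale1r big1 ?addr0 // => l /negPf->.
        by rewrite scale0r.
      under eq_bigr do rewrite scalerBl.
      by rewrite sumrB !del eqB subrr.
    by rewrite eqxx (negPf neq) subr0 oner_eq0.
  exists (codom B); rewrite size_codom card_ord; split=> //; split.
    by move=> p /codomP[i ->]; apply: homB.
  split; first by rewrite /codom /image_mem map_inj_uniq ?enum_uniq.
  move=> c; rewrite big_image /= => Ic p /codomP[i ->].
  exact: (freeB (c \o B) Ic).
move=> s [homs [us frees]]; rewrite leqNgt; apply/negP => ltn.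
(* More than [n] forms have linearly dependent coordinate rows, and such a dependency is a relation
   modulo [I]. *)
have /fin_all_exists [C IC] : forall j : 'I_(size s), exists c : 'I_n -> k,
    I (s`_j - \sum_i c i *: B i).
  by move=> j; apply: spanB; apply: homs; apply: mem_nth.
pose A := \matrix_(j < size s, i < n) C j i.
have [v vA v0] : exists2 v : 'rV_(size s), v *m A = 0 & v != 0.
  have : kermx A != 0.
    rewrite -mxrank_eq0 mxrank_ker subn_eq0 -ltnNge.
    exact: leq_ltn_trans (rank_leq_col A) ltn.
  case/rowV0Pn => v /sub_kermxP vA v0; by exists v.
case/eqP: v0; apply/rowP => j; rewrite mxE.
(* [indep_mod] indexes coefficients by polynomials, so the vector is transported along positions in
   [s], with [0] off the list. *)
pose c p := oapp (fun j => v 0 j) 0 (insub (index p s) : option 'I_(size s)).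
have cE (l : 'I_(size s)) : c s`_l = v 0 l.
  by rewrite /c index_uniq // insubT //= => lt; congr (v 0 _); apply: val_inj.
rewrite -cE; apply: frees; last exact: mem_nth.
rewrite (big_nth 0) big_mkord.
rewrite (_ : \sum_i _ = \sum_(l < size s) v 0 l *: (s`_l - \sum_i C l i *: B i)).
  by apply: is_ideal_sum => // l _; apply: is_idealZ.
under eq_bigr do rewrite cE; under [RHS]eq_bigr do rewrite scalerBr.
rewrite sumrB -[LHS]subr0; congr (_ - _).
under eq_bigr do rewrite scaler_sumr; rewrite exchange_big /= big1 // => i _.
under eq_bigr do rewrite scalerA; rewrite -scaler_suml.
have /rowP/(_ i) := vA; rewrite !mxE.
by under eq_bigr do rewrite mxE; move=> ->; rewrite scale0r.
Qed.

End Basis.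

(** * The Hilbert function under a basic double link *)

Section Step.
Variables (I J : R -> Prop) (b : k) (F : R) (m : nat).
Hypotheses (idI : is_ideal I) (idJ : is_ideal J).
Hypothesis JE : forall f, bdl_ideal I F (yline b) f <-> J f.
Hypothesis J_colon : forall g, J (yline b * g) -> I g.
Hypotheses (F_form : F \is m.-homog) (F_size : size (dehom b F) = m.+1).

(** Mirrors the exact sequence from [R/I] shifted by one, through [R/J], to [R/(F, yline b)];
    [minn t.+1 m] is the dimension of the last term in degree [t], with a basis of monomials in
    [X0], [X2]. *)
Definition step_basis t n (B : 'I_n -> R) (i : 'I_(n + minn t.+1 m)) : R :=
  match split i with
  | inl j => yline b * B j
  | inr a => X0 ^+ a * X2 ^+ (t - a)
  end.

Lemma step_sum t n (B : 'I_n -> R) (c : 'I_(n + minn t.+1 m) -> k) :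
  \sum_i c i *: step_basis B i =
    yline b * (\sum_j c (lshift _ j) *: B j) +
    \sum_(a < minn t.+1 m) c (rshift _ a) *: (X0 ^+ a * X2 ^+ (t - a)).
Proof.
rewrite big_split_ord /step_basis; congr (_ + _).
  rewrite mulr_sumr; apply: eq_bigr => j _.
  by rewrite (unsplitK (inl j)) scalerAr.
by apply: eq_bigr => a _; rewrite (unsplitK (inr a)).
Qed.

(** Independence: on the line, the monomial part has degree below [m] yet is divisible by [F] of
    degree [m], so it vanishes, and the rest descends through [J_colon]. Spanning: divide by [F] on
    the line, then divide what is left by the line. *)
Lemma step_basis_mod t n (B : 'I_n -> R) :
  (if t is t'.+1 then basis_mod I t' B else n = 0%N) ->
  basis_mod J t (@step_basis t n B).
Proof.
move=> basB; set q := minn t.+1 m.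
have [J0 addJ mulJ] := idJ.
split=> [i|c Jc|f homf].
- rewrite /step_basis; case: splitP => [j _|a _].
    case: (t) basB => [n0|t' [homB _ _]]; first by case: (ord_empty n0 j).
    exact: (dhomogM (yline_form b) (homB j)).
  by apply: monom_form; have := ltn_ord a; lia.
- move: Jc; rewrite step_sum; set g := \sum_j _ => Jc.
  have low0 a : c (rshift n a) = 0.
    pose p := \poly_(i < q) oapp (fun a => c (rshift n a)) 0 (insub i).
    have pE (l : 'I_q) : p`_l = c (rshift n l).
      by rewrite coef_poly ltn_ord valK.
    rewrite -pE (_ : p = 0) ?coef0 //.
    have /JE [h [f [_ /(congr1 (dehom b))]]] := Jc.
    rewrite !raddfD /= !dehomM !dehom_yline !mul0r !add0r raddf_sum /=.
    under eq_bigr do rewrite dehomZ dehom_monom -pE.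
    rewrite -(@poly_def _ q (fun i => p`_i)) (_ : \poly_(i < q) _ = p); last first.
      by apply/polyP => i; rewrite coef_poly; case: ifP => // ltq; rewrite coef_poly ltq.
    move=> eqp; apply/eqP/negPn/negP => p0.
    have : dehom b F %| p by rewrite eqp dvdp_mulr.
    move/(dvdp_leq p0); rewrite F_size ltnNge.
    by rewrite (leq_trans (size_poly _ _)) // geq_minr.
  have /J_colon Ig : J (yline b * g).
    move: Jc; rewrite [X in _ + X]big1 ?addr0 // => a _.
    by rewrite low0 scale0r.
  move=> i; case: (split_ordP i) => [j ->|a ->] //.
  case: (t) basB Ig => [n0|t' [_ freeB _]] Ig; first by case: (ord_empty n0 j).
  exact: (freeB (fun j => c (lshift _ j)) Ig).
set p := dehom b f; set Phi := dehom b F; have [lep _] := dehom_form b homf;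
  rewrite -/p in lep.
(* When [t < m] the restriction of [f] is its own remainder and the quotient is zero. *)
pose W := if (m <= t)%N then homz (t - m) (p %/ Phi) else 0.
have Phi0 : Phi != 0 by rewrite -size_poly_eq0 F_size.
have ler : (size (p %% Phi)%R <= q)%N.
  rewrite leq_min (leq_trans (leq_modp _ _)) //=.
  by rewrite -ltnS -F_size ltn_modp.
have FW : F * W \is t.-homog.
  rewrite /W; case: ifP => [lemt|_]; last by rewrite mulr0 rpred0.
  rewrite -[in X in X.-homog](subnKC lemt); apply: dhomogM => //.
  exact: homz_form.
have dW : dehom b (F * W) = (p %/ Phi) * Phi.
  rewrite dehomM mulrC; congr (_ * _); rewrite /W; case: leqP => lemt.
    by rewrite dehom_homz // size_divp // F_size leq_subLR addnS subnKC.
  by rewrite raddf0 divp_small // F_size ltnS (leq_trans lep).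
pose f' := f - F * W - homz t (p %% Phi).
have homf' : f' \is t.-homog by rewrite !rpredB ?homz_form.
have df' : dehom b f' = 0.
  rewrite !raddfB /= dW dehom_homz; last by rewrite (leq_trans ler) // geq_minl.
  by rewrite -/p {1}(divp_eq p Phi) addrAC addrK subrr.
have [_ [g []]] := dehom_form b homf'; rewrite df' homz0 add0r => eqf' homg.
have [c Ic] : exists c : 'I_n -> k, I (g - \sum_i c i *: B i).
  case: (t) basB homg => [n0 /eqP->|t' [_ _ spanB]]; last exact: spanB.
  exists (fun _ => 0); rewrite big1 ?subrr; first by case: idI.
  by move=> i _; rewrite scale0r.
exists (fun i => match split i with inl j => c j | inr a => (p %% Phi)`_a end).
apply/JE; exists (g - \sum_i c i *: B i), W; split=> //.
rewrite step_sum.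
under eq_bigr do rewrite (unsplitK (inl _)).
under [X in _ - (_ + X)]eq_bigr do rewrite (unsplitK (inr _)).
rewrite -(@homz_trunc t q); last by rewrite ler geq_minl.
rewrite mulrBr -eqf' /f'; ring.
Qed.

End Step.
End Hilbert.

(** * Numerical functions and standard O-sequences *)

Section Combinatorics.

(** The head of [s] is the degree of the last link performed. *)
Fixpoint hfun (s : seq nat) (t : nat) : nat :=
  if s is m :: s' then (if t is t'.+1 then hfun s' t' else 0) + minn t.+1 m
  else 0.

(** Counts the intervals [[q, q + s_q)] containing [t]: each link contributes one, shifted by the
    number of later links. *)
Definition ocount (s : seq nat) (t : nat) : nat :=
  \sum_(q < size s) (q <= t < q + nth 0 s q).

Lemma diff1_hfun s t : diff1 (hfun s) t = Posz (ocount s t).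
Proof.
elim: s t => [|m s IHs] t.
  by rewrite /ocount big_ord0 /diff1; case: t.
have -> : ocount (m :: s) t =
    (t < m) + (if t is t'.+1 then ocount s t' else 0).
  rewrite /ocount big_ord_recl /= add0n; congr addn.
  by case: t => [|t]; [rewrite big1|apply: eq_bigr].
case: t => [|t]; first by rewrite /diff1 /=; lia.
by have := IHs t; rewrite /diff1 /=; case: t => [|t] /=; lia.
Qed.

Section StandardOseq.
Variable m : seq nat.
Hypothesis m_gt0 : forall i, i < size m -> 0 < nth 0 m i.
Hypothesis m_no3 : forall i, i.+2 < size m ->
  nth 0 m i = nth 0 m i.+1 -> nth 0 m i.+1 = nth 0 m i.+2 -> False.

Let p := size m.
Let b t i : nat := p - i <= t < p - i + mth m i.

Lemma s_comp_sum t j : j < p ->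
  (if p - j.+1 <= t then s_comp m j.+1 (t - (p - j.+1)) else 0) +
    (if (j.+1 < p) && (mth m j.+1 == mth m j.+2) then b t j.+1 else 0) =
  b t j.+1 + (if (j < p) && (mth m j == mth m j.+1) then b t j else 0).
Proof.
move=> ltj; have mj : 0 < mth m j.+1 := m_gt0 ltj; rewrite /s_comp -/p ltj [j.+1.-1]/=.
have [/andP[ltj1 /eqP eq2]|neq2] := boolP (_ && _).
  (* With no value occurring three times, two carries are never pending together; [j = 0] is
     excluded because [m_0 = 0] and entries are positive. *)
  rewrite if_same add0n (_ : (mth m j == _) = false) ?addn0 //.
  apply/eqP => eq1; case: j ltj mj ltj1 eq2 eq1 => [|j] ltj mj ltj1 eq2 eq1.
    by move: mj eq1; rewrite /mth; lia.
  exact: (m_no3 ltj1 eq1 eq2).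
rewrite addn0; case: eqP => [eq1|_]; last first.
  rewrite addn0 /b; case: (leqP (p - j.+1) t) => //= let1.
  by rewrite -ltn_subLR //; case: ltnP.
have ltj' : p - j = (p - j.+1).+1 by lia.
rewrite /b eq1 ltj'; move: (p - j.+1) (mth m j.+1) mj => a c c0.
case: (leqP a t) => /= let1; last by rewrite ltnNge (ltnW let1).
case: eqP => [?|neq0]; first by lia.
case: ltnP => ?; first by lia.
by case: eqP => ?; lia.
Qed.

Lemma std_Oseq_ocount t : std_Oseq m t = ocount (rev m) t.
Proof.
have partial j : j <= p ->
    \sum_(1 <= i < j.+1 | p - i <= t) s_comp m i (t - (p - i)) +
    (if (j < p) && (mth m j == mth m j.+1) then b t j else 0) =
    \sum_(1 <= i < j.+1) b t i.
  elim: j => [|j IHj] lej.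
    rewrite !big_geq // add0n; case: ifP => // _.
    by rewrite /b /mth addn0 subn0; lia.
  rewrite big_mkcond big_nat_recr //= -big_mkcond [RHS]big_nat_recr //=.
  rewrite -IHj ?(ltnW lej) // -addnA s_comp_sum //; lia.
have := partial p (leqnn p); rewrite ltnn addn0 /std_Oseq -/p => ->.
rewrite /ocount size_rev -/p.
rewrite -(big_mkord xpredT (fun q => nat_of_bool (q <= t < q + nth 0 (rev m) q))).
rewrite [RHS]big_nat_rev /= big_add1 /= big_nat [RHS]big_nat.
apply: eq_bigr => i /= lti; rewrite nth_rev -/p; last by lia.
by rewrite /b /= add0n (_ : p - (p - i.+1).+1 = i)%N //; lia.
Qed.

End StandardOseq.

(** * The pseudo type vector *)

Section PseudoType.
Variable T : seq nat.
Hypothesis typeT : two_type T.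
Let N := last 0 T.

Lemma two_type_gt0 n : n \in T -> 0 < n.
Proof. by case: typeT => _ [+ _]; apply. Qed.

Lemma two_type_uniq : uniq T.
Proof. by case: typeT => _ [_ /(sorted_uniq ltn_trans ltnn)]. Qed.

Lemma sorted_leq_last (s : seq nat) n : sorted leq s -> n \in s -> n <= last 0 s.
Proof.
move=> ss /(nthP 0)[i lti <-]; rewrite -nth_last.
by apply: (sorted_leq_nth leq_trans leqnn) => //; rewrite ?inE /=; case: (size s) lti.
Qed.

Lemma two_type_le_last n : n \in T -> n <= N.
Proof.
apply: sorted_leq_last; case: typeT => _ [_]; apply: sub_sorted => i j; exact: ltnW.
Qed.

Lemma last_two_type : N \in T.
Proof. by rewrite /N; case: typeT => + _; case: (T) => //= a s _; apply: mem_last. Qed.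

Lemma count_pseudo (P : pred nat) :
  count P (pseudo_type T) = count P T + count (P \o double) T.
Proof.
rewrite /pseudo_type (permP (permEl (perm_sort _ _))).
by elim: (T) => //= n s ->; lia.
Qed.

Lemma mem_pseudo n : (n \in pseudo_type T) =
  (n \in T) || (n \in map double T).
Proof.
by rewrite -!has_pred1 !has_count count_pseudo count_map addn_gt0.
Qed.

Lemma pseudo_sorted : sorted leq (pseudo_type T).
Proof. by apply: sort_sorted; apply: leq_total. Qed.

Lemma last_pseudo : last 0 (pseudo_type T) = N.*2.
Proof.
apply/eqP; rewrite eqn_leq; apply/andP; split; last first.
  apply: (sorted_leq_last pseudo_sorted).
  by rewrite mem_pseudo map_f ?orbT // last_two_type.
have : last 0 (pseudo_type T) \in pseudo_type T.
  have : N \in pseudo_type T by rewrite mem_pseudo last_two_type.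
  by case: (pseudo_type T) => // a s _; apply: mem_last.
rewrite mem_pseudo => /orP[/two_type_le_last|/mapP[n /two_type_le_last ? ->]];
  lia.
Qed.

Lemma pseudo_gt0 i : i < size (pseudo_type T) -> 0 < nth 0 (pseudo_type T) i.
Proof.
move/(mem_nth 0); rewrite mem_pseudo => /orP[/two_type_gt0 //|/mapP[n]].
by move/two_type_gt0 => ? ->; lia.
Qed.

(** A value occurs at most once in [T] and at most once among the doubles. *)
Lemma pseudo_no3 i : let m := pseudo_type T in i.+2 < size m ->
  nth 0 m i = nth 0 m i.+1 -> nth 0 m i.+1 = nth 0 m i.+2 -> False.
Proof.
move=> m lti eq1 eq2; have : count_mem (nth 0 m i) m <= 2.
  rewrite count_pseudo count_uniq_mem ?two_type_uniq //.
  rewrite -(@count_map _ _ double (pred1 _)).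
  rewrite count_uniq_mem ?map_inj_uniq ?two_type_uniq //; last exact: double_inj.
  by do 2!case: (_ \in _).
rewrite -{2}(cat_take_drop i m) count_cat.
do 3![rewrite (drop_nth 0) /=; last by lia].
by rewrite -eq2 -eq1 eqxx; lia.
Qed.

Lemma count_geq_uniq (s : seq nat) v M : uniq s -> {in s, forall n, n <= M} ->
  count (leq v) s <= M.+1 - v.
Proof.
move=> us leM; rewrite -size_filter -(size_iota v (M.+1 - v)).
apply: uniq_leq_size; first exact: filter_uniq.
by move=> n; rewrite mem_filter mem_iota => /andP[lev /leM ?]; lia.
Qed.

(** With [v] the entry at [q], at least [q + 1] entries are [>= v]; distinctness allows at most
    [N + 1 - v] of them from [T] and [N + 1 - uphalf v] from the doubles. Hence every interval
    counted by [ocount] ends by [2N]. *)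
Lemma pseudo_bound q : q < size (pseudo_type T) ->
  q + nth 0 (rev (pseudo_type T)) q <= N.*2.
Proof.
set m := pseudo_type T => ltq; rewrite nth_rev //.
set i := size m - q.+1; have lti : i < size m by rewrite /i; lia.
set v := nth 0 m i; have v0 : 0 < v := pseudo_gt0 lti.
have leN : v <= N.*2.
  by rewrite -last_pseudo; apply: sorted_leq_last pseudo_sorted (mem_nth _ lti).
have : q < count (leq v) m.
  rewrite -(cat_take_drop i m) count_cat (_ : count _ (drop i m) = q.+1) ?leq_addl //.
  rewrite -[RHS](_ : size (drop i m) = _); last by rewrite size_drop /i; lia.
  apply/eqP; rewrite -all_count; apply/(all_nthP 0) => j; rewrite size_drop => ltj.
  rewrite nth_drop; apply: (sorted_leq_nth leq_trans leqnn) pseudo_sorted _ _ _ _ _;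
    rewrite ?inE -/m; lia.
rewrite count_pseudo.
have := @count_geq_uniq T v N two_type_uniq two_type_le_last.
have := @count_geq_uniq T (uphalf v) N two_type_uniq two_type_le_last.
rewrite (_ : count (leq (uphalf v)) T = count (leq v \o double) T); first lia.
by apply: eq_count => n /=; lia.
Qed.

Lemma ocount_pseudo_eq0 : ocount (rev (pseudo_type T)) N.*2 = 0.
Proof.
rewrite /ocount big1 // => -[q]; rewrite size_rev => /= /pseudo_bound leN.
by rewrite [X in _ && X]ltnNge leN andbF.
Qed.

(** The largest entry [2N], at shift [0], already covers [[0, 2N)]. *)
Lemma ocount_pseudo_gt0 t : t < N.*2 -> 0 < ocount (rev (pseudo_type T)) t.
Proof.
rewrite -last_pseudo /ocount; case/lastP: (pseudo_type T) => // s x.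
by rewrite last_rcons rev_rcons big_ord_recl /= add0n => ->.
Qed.

End PseudoType.
End Combinatorics.

(** * The order of the links *)

Section Steps.
Variable T : seq nat.
Hypothesis typeT : two_type T.

(* The entries of T' in order, each paired with the row it comes from. *)
Definition steps : seq (nat * nat) :=
  sort (relpre fst leq) (flatten [seq [:: (n, n); (n.*2, n)] | n <- T]).

Definition visits (s : seq (nat * nat)) (n : nat) : nat :=
  count (fun x => x.2 == n) s.

Lemma map_fst_steps : map fst steps = pseudo_type T.
Proof.
rewrite /steps /pseudo_type -sort_map map_flatten -map_comp.
by [].
Qed.

Lemma mem_steps x :
  (x \in steps) = (x.2 \in T) && ((x.1 == x.2) || (x.1 == x.2.*2)).
Proof.
rewrite mem_sort; apply/flatten_mapP/andP => [[n nT]|[xT /orP eqx]].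
  by rewrite !inE => /orP[]/eqP-> /=; rewrite eqxx ?orbT.
exists x.2 => //; rewrite !inE; case: x xT eqx => a n /= _.
by case=> /eqP->; rewrite eqxx ?orbT.
Qed.

Lemma steps_uniq : uniq steps.
Proof.
rewrite sort_uniq; have := two_type_uniq typeT.
have : forall n, n \in T -> 0 < n by apply: two_type_gt0.
elim: (T) => //= n s IHs s0 /andP[ns us]; rewrite IHs // ?andbT; last first.
  by move=> i si; apply: s0; rewrite inE si orbT.
have n0 : 0 < n by apply: s0; rewrite mem_head.
have notin a : (a, n) \notin flatten [seq [:: (n, n); (n.*2, n)] | n <- s].
  apply/negP => /flatten_mapP[i si]; rewrite !inE => /orP[]/eqP[_ eqn];
    by rewrite eqn si in ns.
rewrite inE negb_or !notin !andbT xpair_eqE eqxx andbT.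
by apply/eqP; lia.
Qed.

Lemma visitsE (s : seq (nat * nat)) n : uniq s -> {subset s <= steps} ->
  n \in T -> visits s n = ((n, n) \in s) + ((n.*2, n) \in s).
Proof.
move=> us ss nT; have n0 := two_type_gt0 typeT nT.
rewrite -!count_uniq_mem // -count_predUI.
rewrite [X in _ = _ + X](_ : _ = 0) ?addn0; last first.
  apply/eqP; rewrite -leqn0 -ltnS ltnNge -has_count.
  apply/negP => /hasP[x _ /andP[/eqP-> /eqP[]]]; lia.
apply: eq_in_count => -[a i] /ss; rewrite mem_steps /= => /andP[_ eqa].
rewrite !xpair_eqE -andb_orl; case: eqP => [eqi|_]; last by rewrite andbF.
by rewrite -eqi eqa.
Qed.

(** Sorting puts [(n, n)] before [(n.*2, n)], so the visits so far determine [m]; all earlier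
    entries are at most [m], which bounds the other rows. These are the hypotheses of a single
    link. *)
Lemma visits_step pre m n post : steps = pre ++ (m, n) :: post ->
  [/\ n \in T, visits pre n <= 1, m = (visits pre n).+1 * n
    & forall i, i \in T -> visits pre i <= 2 /\ visits pre i * i <= m].
Proof.
move=> eqs; have := steps_uniq; rewrite eqs cat_uniq /= => /and3P[upre].
rewrite negb_or => /andP[xpre dpre] /andP[xpost _].
have : (m, n) \in steps by rewrite eqs mem_cat mem_head orbT.
rewrite mem_steps /= => /andP[nT eqm].
have n0 := two_type_gt0 typeT nT.
have subpre : {subset pre <= steps} by move=> x xp; rewrite eqs mem_cat xp.
have : sorted (relpre fst leq) steps.
  by apply: sort_sorted => x y; apply: leq_total.
rewrite eqs sorted_pairwise; last by move=> y x z; apply: leq_trans.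
rewrite pairwise_cat /= => /and3P[/allrelP prem _ /andP[/allP mpost _]].
have pre_le a i : (a, i) \in pre -> a <= m.
  by move=> ap; apply: (prem (a, i) (m, n)) => //; apply: mem_head.
have lt_pre a i : (a, i) \in steps -> a < m -> (a, i) \in pre.
  rewrite eqs mem_cat inE => /or3P[//|/eqP[-> _]|/mpost /= lema] ltam; lia.
have vE i := visitsE upre subpre (n := i).
have [v1 vm] : visits pre n <= 1 /\ m = (visits pre n).+1 * n.
  rewrite vE //; case/orP: eqm => /eqP eqm.
    have nn : (n, n) \notin pre by move: xpre; rewrite eqm.
    by rewrite (negPf nn); case: (boolP (_ \in pre)) => [/pre_le|_]; lia.
  have nn : (n.*2, n) \notin pre by move: xpre; rewrite eqm.
  have np : (n, n) \in pre by rewrite lt_pre ?mem_steps ?nT ?eqxx //; lia.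
  by rewrite (negPf nn) np; lia.
split=> // i iT; rewrite vE //; split; first by case: (_ \in _); case: (_ \in _).
have := two_type_gt0 typeT iT.
case: (boolP ((i, i) \in pre)) => [/pre_le|_];
  case: (boolP ((i.*2, i) \in pre)) => [/pre_le|_]; lia.
Qed.

Lemma visits_steps n : n \in T -> visits steps n = 2.
Proof.
by move=> nT; rewrite visitsE ?steps_uniq // !mem_steps /= nT !eqxx orbT.
Qed.

End Steps.

(** * Assembling the chain and its Hilbert function *)

Section Chain.
Local Open Scope ring_scope.
Variable k : fieldType.
Hypothesis char0 : [pchar k] =i pred0.
Variable T : seq nat.
Hypothesis typeT : two_type T.
Notation R := {mpoly k[3]}.

Let N := last 0%N T.
Let I (s : seq (nat * nat)) : R -> Prop := @conf k T N (visits s).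

(** The intermediate ideals are identified only up to pointwise equivalence. *)
Lemma bdl_chain_ext (I1 I2 J : R -> Prop) s : (forall f, I1 f <-> I2 f) ->
  bdl_chain I1 s J -> bdl_chain I2 s J.
Proof.
elim: s I1 I2 => [|x s IHs] I1 I2 eqI /=.
  by move=> eqJ f; rewrite eqJ.
case=> -[F0 [G0 [IF regFG]]] chain; split.
  by do ![split=> //]; apply/eqI.
apply: IHs chain => f; split=> -[a [b [Ia ->]]]; exists a, b; split=> //;
  exact/eqI.
Qed.

Lemma hdim_ext (I1 I2 : R -> Prop) t n : (forall f, I1 f <-> I2 f) ->
  hdim I1 t n -> hdim I2 t n.
Proof.
move=> eqI; have ext s : indep_mod I1 t s <-> indep_mod I2 t s.
  by split=> -[homs [us frees]]; split=> //; split=> // c /eqI; apply: frees.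
case=> -[s [ind sz]] le; split; first by exists s; split=> //; apply/ext.
by move=> s' /ext; apply: le.
Qed.

Lemma conf_ext e1 e2 (f : R) : e1 =1 e2 -> conf T N e1 f -> conf T N e2 f.
Proof. by move=> eqe If n j nT ltj; rewrite -eqe; apply: If. Qed.

Lemma visits_rcons s m n i : visits (rcons s (m, n)) i = incr (visits s) n i.
Proof.
rewrite /visits /incr -cats1 count_cat /= addn0 eq_sym.
by case: eqP => _; rewrite ?addn1 ?addn0.
Qed.

Let leTN : forall n, n \in T -> (n <= N)%N := two_type_le_last typeT.
Let T_gt0 : forall n, n \in T -> (0 < n)%N := two_type_gt0 typeT.

Lemma bdl_visits pre m n post : steps T = pre ++ (m, n) :: post ->
  forall f, bdl_ideal (I pre) (curve k N m) (yline (height k N n)) f <->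
    I (rcons pre (m, n)) f.
Proof.
move=> eqs; have [nT v1 -> vle] := visits_step typeT eqs => f.
rewrite (bdl_conf char0 leTN nT v1); last by move=> i /vle.
by split; apply: conf_ext => i; rewrite visits_rcons.
Qed.

(** After all steps every row has been visited twice, and multiplicity two is the squared point
    ideal by [van2_square]. *)
Lemma first_infE f : I (steps T) f <-> @first_inf_nbhd_ideal k T f.
Proof.
split=> [If i j lti ltj|If n j nT ltj].
  by apply/van2_square; have := If _ j (mem_nth 0%N lti) ltj;
    rewrite visits_steps ?mem_nth.
have [i lti eqn] := nthP 0%N nT; rewrite -eqn in ltj *.
by rewrite visits_steps ?mem_nth //; apply/van2_square/If.
Qed.

Lemma steps_chain : bdl_chain (@unit_ideal k)
  [seq (curve k N x.1, yline (height k N x.2)) | x <- steps T]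
  (@first_inf_nbhd_ideal k T).
Proof.
have chain post pre : steps T = pre ++ post -> bdl_chain (I pre)
    [seq (curve k N x.1, yline (height k N x.2)) | x <- post]
    (@first_inf_nbhd_ideal k T).
  elim: post pre => [|[m n] post IHpost] pre eqs /=.
    by rewrite cats0 in eqs => f; rewrite -eqs first_infE.
  have [nT v1 eqm vle] := visits_step typeT eqs; split.
    by rewrite eqm; apply: bdl_step_conf => // i /vle; rewrite -eqm.
  apply: bdl_chain_ext (IHpost (rcons pre (m, n)) _); last by rewrite cat_rcons.
  by move=> f; rewrite (bdl_visits eqs).
(* Before any visit all multiplicities are zero, so the ideal is the unit ideal. *)
by apply: bdl_chain_ext (chain _ [::] (erefl _)) => f; split=> // _ n j _ _.
Qed.

Lemma size_dehom_curve n e : n \in T -> (e <= 1)%N ->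
  size (dehom (height k N n) (curve k N (e.+1 * n))) = (e.+1 * n).+1.
Proof.
move=> nT le1; rewrite dehom_yres curve_yres ?leTN // rmorph_prod /=.
under eq_bigr do rewrite rmorphXn /= dehom_xline.
rewrite prodrXl.
have monP : \prod_(a <- pts k n) ('X - a%:P) \is monic by apply: monic_prod_XsubC.
rewrite -[LHS]prednK; last by rewrite size_poly_gt0 expf_neq0 ?monic_neq0.
by rewrite size_exp size_prod_XsubC size_map size_iota mulnC.
Qed.

(** Induction on the links performed, last one first to match [hfun]; the empty basis serves the
    unit ideal. *)
Lemma hilbert_visits pre post : steps T = pre ++ post -> forall t,
  exists B : 'I_(hfun (rev (map fst pre)) t) -> R, basis_mod (I pre) t B.
Proof.
elim/last_ind: pre post => [|pre [m n] IHpre] post eqs t.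
  exists (fun _ => 0); split=> [i|c _ [] //|f _].
    exact: rpred0.
  by exists (fun _ => 0) => i j _ _; split.
rewrite cat_rcons in eqs; have IH := IHpre _ eqs.
have [nT v1 eqm vle] := visits_step typeT eqs.
rewrite map_rcons rev_rcons /=.
pose q := (if t is t'.+1 then hfun (rev (map fst pre)) t' else 0)%N.
have [B basB] : exists B : 'I_q -> R,
    if t is t'.+1 then basis_mod (I pre) t' B else q = 0%N.
  by rewrite /q; case: (t) => [|t']; [exists (fun _ => 0)|apply: IH].
exists (@step_basis k (height k N n) m t q B).
apply: (@step_basis_mod _ (I pre) _ _ (curve k N m)) basB.
- exact: conf_ideal.
- exact: conf_ideal.
- exact: bdl_visits eqs.
- move=> g Ig; apply: (conf_colon char0 leTN nT v1).
  by apply: conf_ext Ig => i; rewrite visits_rcons.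
- exact: curve_form.
- by rewrite eqm; apply: size_dehom_curve.
Qed.

End Chain.


Theorem theorem5p4 (k : fieldType) (T : seq nat) :
  ([pchar k] =i pred0)%R ->
  two_type T ->
  (* (i) Z is obtained from the empty scheme by finitely many basic double links *)
  (exists s : seq ({mpoly k[3]} * {mpoly k[3]}),
      bdl_chain (@unit_ideal k) s (@first_inf_nbhd_ideal k T)) /\
  (exists h : nat -> nat,
      (* h is the Hilbert function of Z *)
      (forall t, hdim (@first_inf_nbhd_ideal k T) t (h t)) /\
      (* (ii) Delta h is the standard O-sequence of T' *)
      (forall t, diff1 h t = ((std_Oseq (pseudo_type T) t)%:Z)%R) /\
      (* (iii) reg Z = m_{2r} = 2 n_r *)
      (diff1 h (last 0%N (pseudo_type T)) = 0%R /\
       (forall t, (t < last 0%N (pseudo_type T))%N -> diff1 h t <> 0%R)) /\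
      last 0%N (pseudo_type T) = (last 0%N T).*2).
Proof.
move=> char0 typeT; split.
  by exists [seq (curve k (last 0 T) x.1, yline (height k (last 0 T) x.2)) | x <- steps T];
    apply: steps_chain.
exists (hfun (rev (pseudo_type T))); split=> [t|].
  have [B basB] := hilbert_visits char0 typeT (esym (cats0 _)) t.
  rewrite -map_fst_steps; apply: hdim_ext (first_infE typeT) _.
  by apply: basis_hdim basB; apply: conf_ideal.
rewrite (last_pseudo typeT); split=> [t|].
  by rewrite diff1_hfun std_Oseq_ocount //; [apply: pseudo_gt0|apply: pseudo_no3].
split=> //; split=> [|t ltt]; rewrite diff1_hfun ?ocount_pseudo_eq0 //.
by have := ocount_pseudo_gt0 typeT ltt; case: ocount.
Qed.
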